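(* For every $n\ge 1$, $|\mathrm{Sort}_n(132,321)|$ equals the $n$-th term of OEIS sequence A102407, i.e. the number of Dyck paths of semilength $n$ that do not contain $dudu$ as a factor (four consecutive steps down, up, down, up).
   Context: A permutation $x$ contains a pattern $p$ if it has a subsequence order-isomorphic to $p$; otherwise it avoids $p$. For a set $T$ of patterns, the map $s_T$ is defined as follows: the entries of the input permutation $x=x_1\cdots x_n$ are read from left to right, with an initially empty stack. At each step, if the input is nonempty and pushing the next input entry onto the stack produces a stack whose contents, read from top to bottom, avoid every pattern in $T$, that entry is pushed; otherwise the top entry of the stack is popped and appended to the output. When the input is exhausted, the remaining stack entries are popped one at a time to the output. $s_T(x)$ is the output word. Write $s_{\sigma,\tau}=s_{\{\sigma,\tau\}}$ and $s=s_{\{21\}}$ (West's stack-sorting map, whose stack is increasing from top to bottom). $\mathrm{Sort}_n(\sigma,\tau)$ is the set of $x\in S_n$ such that $s(s_{\sigma,\tau}(x))=12\cdots n$. A Dyck path of semilength $n$ is a lattice path from $(0,0)$ to $(2n,0)$ with steps $u=(1,1)$ and $d=(1,-1)$ never going below the $x$-axis. *)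

(* Defs.v *)
From mathcomp Require Import all_boot all_fingroup.
Set Implicit Arguments. Unset Strict Implicit. Unset Printing Implicit Defensive.

Definition order_iso (a b : seq nat) : bool :=
  (size a == size b) &&
  [forall i : 'I_(size a), forall j : 'I_(size a),
     (nth 0 a i < nth 0 a j) == (nth 0 b i < nth 0 b j)].

Definition contains (x p : seq nat) : bool :=
  [exists m : (size x).-tuple bool, order_iso (mask m x) p].

Definition avoids (x p : seq nat) : bool := ~~ contains x p.

Definition avoids_all (T : seq (seq nat)) (x : seq nat) : bool :=
  all (avoids x) T.

(* One run of the pattern-avoiding stack.  The stack is a list whose head is
   the top, so the list itself is the stack contents read top to bottom. *)
Fixpoint stack_run (T : seq (seq nat)) (fuel : nat) (inp stk out : seq nat)
  : seq nat :=
  match fuel with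
  | 0 => out ++ stk
  | f.+1 =>
    match inp with
    | [::] => out ++ stk  (* pop the remaining entries one at a time *)
    | a :: inp' =>
      if avoids_all T (a :: stk) then stack_run T f inp' (a :: stk) out
      else match stk with
           | [::] => out ++ inp  (* unreachable for patterns of length >= 2 *)
           | b :: stk' => stack_run T f inp stk' (rcons out b)
           end
    end
  end.

(* s_T ; at most 2 * |x| push/pop steps occur *)
Definition sT (T : seq (seq nat)) (x : seq nat) : seq nat :=
  stack_run T (2 * size x).+1 x [::] [::].

Definition west_s (x : seq nat) : seq nat := sT [:: [:: 2; 1]] x.

Definition s_132_321 (x : seq nat) : seq nat := sT [:: [:: 1; 3; 2]; [:: 3; 2; 1]] x.

Definition perm_word n (s : 'S_n) : seq nat := [seq (val (s i)).+1 | i <- enum 'I_n].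

Definition Sort_132_321 (n : nat) : {set 'S_n} :=
  [set s : 'S_n | west_s (s_132_321 (perm_word s)) == iota 1 n].

(* Dyck paths: true = u = (1,1), false = d = (1,-1) *)
Definition is_dyck (p : seq bool) : bool :=
  (count id p == count negb p) &&
  [forall i : 'I_(size p).+1, count negb (take i p) <= count id (take i p)].

Definition dudu : seq bool := [:: false; true; false; true].

Definition dyck_no_dudu (n : nat) : {set (2 * n).-tuple bool} :=
  [set p : (2 * n).-tuple bool | is_dyck p && ~~ infix dudu p].

(* Main.v *)
(* West's map sorts exactly the 231-avoiding words.  While a permutation goes
   through the (132, 321)-avoiding stack, its left-to-right minima stay at the
   bottom of the stack until the end, so the output lists the other entries in
   some order and then the minima in increasing order.  As 1 is among the
   minima, the output avoids 231 iff the other entries come out in decreasing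
   order.  This happens iff they are decreasing in the input and no two of them
   that are adjacent in position have consecutive values.

   Such a permutation is determined by its non-minima (position i, value a).
   Turning each of them into a valley made of the (n+1-a)-th down step and the
   i-th up step gives a bijection onto Dyck paths: the path stays above the axis
   because an entry at (1-based) position i is a non-minimum iff a + i > n + 1,
   and a factor dudu is a pair of non-minima a+1, a at adjacent positions. *)
Require Import Defs.
From mathcomp Require Import all_boot all_fingroup zify.
Set Implicit Arguments. Unset Strict Implicit. Unset Printing Implicit Defensive.

(** * Pattern-avoiding stacks and West's map *)

Arguments avoids_all T x : simpl never.

Lemma containsP x p :
  reflect (exists2 w, subseq w x & order_iso w p) (contains x p).
Proof.
apply: (iffP existsP) => [[m iso_m]|[w /subseqP[m sz_m ->] iso_m]].
  by exists (mask m x); rewrite ?mask_subseq.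
by exists (tcast sz_m (in_tuple m)); rewrite val_tcast.
Qed.

Lemma order_iso21 a b : order_iso [:: a; b] [:: 2; 1] = (b < a).
Proof.
apply/andP/idP => [[_ /forallP/(_ (@Ordinal 2 1 isT))/forallP/(_ ord0)/eqP //]|ba].
split=> //; apply/forallP=> -[[|[|i]] hi] //; apply/forallP=> -[[|[|j]] hj] //=; lia.
Qed.

Lemma order_iso132 a b c :
  order_iso [:: a; b; c] [:: 1; 3; 2] = (a < c < b).
Proof.
apply/andP/idP => [[_ /forallP H]|/andP[ac cb]].
  have /forallP/(_ (@Ordinal 3 2 isT))/eqP /= -> := H ord0.
  by have /forallP/(_ (@Ordinal 3 1 isT))/eqP /= -> := H (@Ordinal 3 2 isT).
split=> //; apply/forallP=> -[[|[|[|i]]] hi] //;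
  apply/forallP=> -[[|[|[|j]]] hj] //=; lia.
Qed.

Lemma order_iso321 a b c :
  order_iso [:: a; b; c] [:: 3; 2; 1] = (c < b < a).
Proof.
apply/andP/idP => [[_ /forallP H]|/andP[ac cb]].
  have /forallP/(_ ord0)/eqP /= -> := H (@Ordinal 3 1 isT).
  by have /forallP/(_ (@Ordinal 3 1 isT))/eqP /= -> := H (@Ordinal 3 2 isT).
split=> //; apply/forallP=> -[[|[|[|i]]] hi] //;
  apply/forallP=> -[[|[|[|j]]] hj] //=; lia.
Qed.

Lemma order_iso_size w p : order_iso w p -> size w = size p.
Proof. by case/andP=> /eqP. Qed.

Lemma pairwise_subseq2 (r : rel nat) x :
  reflect (forall a b, subseq [:: a; b] x -> r a b) (pairwise r x).
Proof.
apply: (iffP idP) => [pw a b sub_ab|].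
  by have := subseq_pairwise sub_ab pw; rewrite /= andbT; case/andP.
elim: x => //= c x IHx H; apply/andP; split.
  by apply/allP=> d dx; apply: H; rewrite eqxx sub1seq.
apply: IHx => a b sub_ab; apply: H.
by apply: subseq_trans sub_ab (subseq_cons _ _).
Qed.

Lemma avoids21E x : avoids_all [:: [:: 2; 1]] x = pairwise leq x.
Proof.
rewrite /avoids_all /= andbT; apply/idP/pairwise_subseq2 => [/containsP H a b ab|H].
  by rewrite leqNgt; apply/negP=> ba; apply: H; exists [:: a; b]; rewrite ?order_iso21.
apply/containsP=> -[w sub_w iso_w]; move: (order_iso_size iso_w).
case: w sub_w iso_w => [|a [|b [|]]] // ab; rewrite order_iso21.
by rewrite ltnNge H.
Qed.

Definition T132_321 := [:: [:: 1; 3; 2]; [:: 3; 2; 1]].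

Lemma avoids_all_TP x :
  reflect (forall a b c, subseq [:: a; b; c] x ->
             ~~ (a < c < b) && ~~ (c < b < a))
          (avoids_all T132_321 x).
Proof.
rewrite /avoids_all /= andbT.
apply: (iffP andP) => [[/containsP H1 /containsP H2] a b c abc|H].
  apply/andP; split; apply/negP=> h.
    by apply: H1; exists [:: a; b; c]; rewrite ?order_iso132.
  by apply: H2; exists [:: a; b; c]; rewrite ?order_iso321.
split; apply/containsP=> -[w sub_w iso_w]; move: (order_iso_size iso_w);
case: w sub_w iso_w => [|a [|b [|c [|]]]] // abc;
  rewrite ?order_iso132 ?order_iso321 => iso_w _;
  by have := H _ _ _ abc; rewrite iso_w ?andbF.
Qed.

(** Output entries never move again and stack entries leave from top to bottom, so every subsequence
    of [out ++ stk] survives in the final output. *)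
Lemma stack_run_subseq T fuel inp stk out :
  exists2 rest, stack_run T fuel inp stk out = out ++ rest & subseq stk rest.
Proof.
elim: fuel inp stk out => [|f IHf] [|a inp] stk out /=; try by exists stk.
case: ifP => _.
  have [r -> sub_r] := IHf inp (a :: stk) out; exists r => //.
  exact: subseq_trans (subseq_cons _ _) sub_r.
case: stk => [|b stk]; first by exists (a :: inp).
have [r -> sub_r] := IHf (a :: inp) stk (rcons out b); exists (b :: r).
  by rewrite cat_rcons.
by rewrite /= eqxx.
Qed.

(** Each push or pop lowers [2 * size inp + size stk] by exactly one, so this much fuel lets the
    whole input be read. *)
Lemma stack_run_perm T fuel inp stk out : 2 * size inp + size stk < fuel ->
  perm_eq (stack_run T fuel inp stk out) (out ++ stk ++ inp).
Proof.
elim: fuel inp stk out => [|f IHf] [|a inp] stk out //=; first by rewrite cats0.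
move=> lt_f; case: ifP => _.
  apply: (perm_trans (IHf _ _ _ _)); first by rewrite /=; lia.
  by rewrite perm_cat2l perm_sym -cat1s perm_catCA.
case: stk lt_f => [|b stk] //= lt_f.
by apply: (perm_trans (IHf _ _ _ _)); rewrite ?cat_rcons //=; lia.
Qed.

Lemma sT_perm T x : perm_eq (sT T x) x.
Proof. by apply: stack_run_perm => /=; lia. Qed.

(** * West's map: words that it fails to sort and words that it sorts *)

Local Notation T21 := [:: [:: 2; 1]].

Lemma west_run_out fuel inp stk out b m :
    2 * size inp + size stk < fuel -> b \in out -> m \in inp -> m < b ->
  ~~ sorted leq (stack_run T21 fuel inp stk out).
Proof.
move=> lt_f b_out m_inp mb; have := stack_run_perm T21 out lt_f.
have [r -> _] := stack_run_subseq T21 fuel inp stk out.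
rewrite perm_cat2l => /perm_mem/(_ m); rewrite mem_cat m_inp orbT => m_r.
rewrite sorted_pairwise; last exact: leq_trans.
rewrite pairwise_cat; apply/negP=> /andP[/allrelP H _].
by have := H b m b_out m_r; lia.
Qed.

(** As [b < c], the entry [c] cannot be pushed while [b] is in the stack. So [b] is output while [m]
    is still in the input. *)
Lemma west_run_stk fuel inp stk out b c m :
    2 * size inp + size stk < fuel -> b \in stk -> subseq [:: c; m] inp ->
    m < b < c ->
  ~~ sorted leq (stack_run T21 fuel inp stk out).
Proof.
elim: fuel inp stk out => [|f IHf] [|a inp] stk out // lt_f b_stk cm /andP[mb bc].
have m_inp : m \in a :: inp by apply: (mem_subseq cm); rewrite !inE eqxx orbT.
rewrite /stack_run -/stack_run avoids21E; case: ifP => [|_].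
  rewrite /=; case/andP=> /allP/(_ b b_stk) ab _.
  move: cm; rewrite /=; case: eqP => [ca|_] cm; first by lia.
  apply: (IHf) => //=; rewrite ?mb //; first by move: lt_f => /=; lia.
  by rewrite inE b_stk orbT.
case: stk lt_f b_stk => // d stk lt_f; rewrite inE => /predU1P[<-|b_stk].
  apply: (@west_run_out _ _ _ _ b m) => //; rewrite ?mem_rcons ?mem_head //.
  by move: lt_f => /=; lia.
by apply: IHf => //; rewrite ?mb //; move: lt_f => /=; lia.
Qed.

Lemma west_run_231 fuel inp stk out b c m :
    2 * size inp + size stk < fuel -> subseq [:: b; c; m] inp -> m < b < c ->
  ~~ sorted leq (stack_run T21 fuel inp stk out).
Proof.
elim: fuel inp stk out => [|f IHf] [|a inp] stk out // lt_f bcm mbc.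
rewrite /stack_run -/stack_run; case: ifP => [_|_].
  have lt_f' : 2 * size inp + size (a :: stk) < f by move: lt_f => /=; lia.
  move: bcm; rewrite [subseq _ _]/=.
  case: eqP lt_f' => [<-|_] lt_f' sub_inp; last exact: IHf.
  exact: west_run_stk lt_f' (mem_head _ _) sub_inp mbc.
case: stk lt_f => [|d stk] lt_f; last by apply: IHf => //; move: lt_f => /=; lia.
(* An empty stack makes the run return [out ++ inp], which keeps the inversion [b], [m]. *)
have m_inp: subseq [:: b; m] (a :: inp).
  by apply: subseq_trans bcm; rewrite /= eqxx; case: eqP; rewrite /= ?eqxx.
rewrite sorted_pairwise; last exact: leq_trans.
rewrite pairwise_cat; apply/negP=> /and3P[_ _ /pairwise_subseq2/(_ _ _ m_inp)]; lia.
Qed.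

Lemma west_s_231 x b c m :
  subseq [:: b; c; m] x -> m < b < c -> ~~ sorted leq (west_s x).
Proof. by apply: west_run_231; rewrite /=; lia. Qed.


Lemma sorted_leq_pairwise s : sorted leq s = pairwise leq s.
Proof. by rewrite sorted_pairwise //; apply: leq_trans. Qed.

Lemma west_run_decr f o inp stk : sorted leq (catrev o stk) ->
  stack_run T21 (size o + f) (o ++ inp) stk [::] =
  stack_run T21 f inp (catrev o stk) [::].
Proof.
elim: o stk => //= a o IHo stk so; rewrite avoids21E; move: (so).
rewrite sorted_leq_pairwise catrevE pairwise_cat => /and3P[_ _ ->].
by rewrite IHo // catrevE.
Qed.

(** An entry is popped only when it is at most the next input entry, hence at most everything left
    in the stack and the input. This preserves both sortedness hypotheses. *)
Lemma west_run_incr f inp stk out :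
    2 * size inp + size stk < f ->
    sorted leq (out ++ stk) -> sorted leq (out ++ inp) ->
  sorted leq (stack_run T21 f inp stk out).
Proof.
elim: f inp stk out => [|f IHf] [|a inp] stk out // lt_f.
rewrite /stack_run -/stack_run avoids21E !sorted_leq_pairwise !pairwise_cat /=.
case/and3P=> r1 p1 p2 /and4P[]; rewrite allrel_consr => /andP[ra r2] _ q1 q2.
rewrite p2 andbT; case: ifP => [le_a|nle_a].
  rewrite -sorted_leq_pairwise; apply: IHf; first by move: lt_f => /=; lia.
    by rewrite sorted_leq_pairwise pairwise_cat /= allrel_consr ra r1 p1 p2 le_a.
  by rewrite sorted_leq_pairwise pairwise_cat r2 p1 q2.
case: stk lt_f r1 p2 nle_a => // d stk lt_f r1 p2 nle_a.
have da : d <= a.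
  rewrite leqNgt; apply: contraFN nle_a => ad /=; rewrite (ltnW ad) /=.
  case/andP: p2 => /allP dstk _; apply/allP=> e /dstk; lia.
rewrite -sorted_leq_pairwise; apply: IHf; first by move: lt_f => /=; lia.
  by rewrite cat_rcons sorted_leq_pairwise pairwise_cat r1 p1 p2.
rewrite cat_rcons sorted_leq_pairwise pairwise_cat p1 /= !allrel_consr ra r2 da q1 q2.
move: r1; rewrite allrel_consr => /andP[-> _] /=; rewrite andbT.
apply/allP=> e /(allP q1); lia.
Qed.

Lemma west_s_decr_incr o m :
  sorted geq o -> sorted leq m -> sorted leq (west_s (o ++ m)).
Proof.
move=> so sm; rewrite /west_s /sT size_cat.
(* The first [size o] units of fuel push all of [o], which turns the stack into [rev o]. *)
have ->: (2 * (size o + size m)).+1 = size o + (2 * size m + size o).+1 by lia.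
rewrite west_run_decr ?catrevE ?cats0 ?rev_sorted //.
by apply: west_run_incr; rewrite ?size_rev ?rev_sorted.
Qed.

(** * The (132, 321)-avoiding stack *)

Lemma sorted_ltn_pairwise s : sorted ltn s = pairwise ltn s.
Proof. by rewrite sorted_pairwise //; apply: ltn_trans. Qed.

Lemma uniq_catF (s1 s2 : seq nat) x :
  uniq (s1 ++ s2) -> x \in s1 -> (x \in s2) = false.
Proof.
rewrite cat_uniq => /and3P[_ /hasPn H _] x1.
by apply/negbTE; apply: contraL x1 => /H.
Qed.

(** Both 132 and 321 end in a descent, which would have to lie in the increasing part [stk]. *)
Lemma push_sorted a stk : sorted ltn stk -> avoids_all T132_321 (a :: stk).
Proof.
rewrite sorted_ltn_pairwise => /pairwise_subseq2 ps.
apply/avoids_all_TP=> x y z xyz.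
have /ps /= : subseq [:: y; z] stk.
  move: xyz; rewrite [subseq _ _]/=; case: eqP => // _.
  exact: subseq_trans (subseq_cons _ _).
lia.
Qed.

(** As [ms] increases, a pattern would have to consist of [a], [q] and some [r] in [ms]; with
    [a < q] it could only be a 132, that is, [a < r < q]. *)
Lemma push_above a q ms : sorted ltn ms -> a < q ->
    (forall r, r \in ms -> r < q -> r <= a) ->
  avoids_all T132_321 [:: a, q & ms].
Proof.
move=> ms_s aq Hr; apply/avoids_all_TP=> x y z.
rewrite [subseq _ _]/=; case: eqP => [->|_] sub_s; last first.
  have /avoids_all_TP := push_sorted q ms_s; apply.
  by rewrite [subseq _ _]/=.
move: sub_s; case: eqP => [->|_] sub_s.
  by move: sub_s; rewrite sub1seq => /Hr; lia.
move: ms_s; rewrite sorted_ltn_pairwise => /pairwise_subseq2/(_ _ _ sub_s) /=; lia.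
Qed.

Lemma push_blocked a q r ms :
  r \in ms -> (a < r < q) || (r < q < a) -> avoids_all T132_321 [:: a, q & ms] = false.
Proof.
move=> r_ms arq; apply/negP=> /avoids_all_TP/(_ a q r).
rewrite /= !eqxx sub1seq r_ms => /(_ isT); lia.
Qed.

(* [ms] is the list of left-to-right minima read so far, most recent first,
   [q] the last other entry ([N] if there is none), and [g] tells whether [q]
   is still in the stack. *)
Fixpoint sortable_from (N q : nat) (g : bool) (ms inp : seq nat) : bool :=
  if inp is a :: inp' then
    if a < head N ms then sortable_from N q false (a :: ms) inp'
    else [&& a < q, g ==> has (fun r => a < r < q) ms & sortable_from N a true ms inp']
  else true.

Definition has231 (x : seq nat) :=
  exists b c m, subseq [:: b; c; m] x /\ m < b < c.

Definition decr_incr (x : seq nat) :=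
  exists o m, [/\ x = o ++ m, sorted geq o & sorted leq m].

Lemma stack_run_has231 T f inp stk out b c m :
  subseq [:: b; c; m] (out ++ stk) -> m < b < c ->
  has231 (stack_run T f inp stk out).
Proof.
move=> sub_s mbc; exists b, c, m; split=> //.
have [r -> sub_r] := stack_run_subseq T f inp stk out.
by apply: subseq_trans sub_s _; rewrite cat_subseq.
Qed.

Lemma sorted_geq_pairwise s : sorted geq s = pairwise geq s.
Proof. by rewrite sorted_pairwise // => b a c /=; lia. Qed.


(** Invariant: the stack holds the minima, increasing from the top, with at most [q] above them, and
    the non-minima that are already output decrease. A failed test of [sortable_from] produces a 231
    in output and stack, which the rest of the run preserves. *)
Lemma sortable_from_stack_run N f inp q (g : bool) ms out :
    2 * size inp + g < f -> all (fun a => a < N) inp ->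
    uniq (out ++ nseq g q ++ ms ++ inp) ->
    sorted ltn ms -> sorted geq (out ++ nseq g q) ->
    all (fun a => q <= a) out ->
    (q < N -> [/\ ms != [::], head N ms < q & q \in out ++ nseq g q]) ->
    (g -> q < N) -> q <= N ->
  let res := stack_run T132_321 f inp (nseq g q ++ ms) out in
  if sortable_from N q g ms inp then decr_incr res else has231 res.
Proof.
elim: inp f q g ms out => [|a inp IHi] f q g ms out.
  move=> lt_f _ _ s_ms s_o _ _ _ _; case: f lt_f => // f _.
  exists (out ++ nseq g q), ms; rewrite /= catA; split=> //.
  by apply: sub_sorted s_ms => x y; lia.
(* The situation where the stack holds only minima; popping [q] leads back to it. *)
have popped f' out' : 2 * size (a :: inp) < f' -> all (fun a => a < N) (a :: inp) ->
    uniq (out' ++ ms ++ a :: inp) ->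
    sorted ltn ms -> sorted geq out' -> all (fun a => q <= a) out' ->
    (q < N -> [/\ ms != [::], head N ms < q & q \in out']) -> q <= N ->
    let res := stack_run T132_321 f' (a :: inp) ms out' in
    if sortable_from N q false ms (a :: inp) then decr_incr res else has231 res.
  case: f' => // f' lt_f /andP[aN inpN] uq s_ms s_o out_q qP qN.
  rewrite [sortable_from _ _ _ _ _]/= [stack_run _ _ _ _ _]/= push_sorted //=.
  have uq' : uniq (out' ++ [:: a] ++ ms ++ inp).
    apply: etrans uq; apply: perm_uniq.
    by rewrite perm_cat2l (perm_catCA [:: a] ms inp).
  case a_nmin: (a < head N ms).
    apply: (IHi f' q false (a :: ms) out') => //=; rewrite ?cats0 //=.
    - by move: lt_f => /=; lia.
    - by case: ms s_ms a_nmin {uq uq' qP} => //= r ms -> ->.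
    - by move=> /qP[_ lt_q q_out]; split=> //; apply: ltn_trans lt_q.
  have [r [ms' def_ms]] : exists r ms', ms = r :: ms'.
    case: (ms) a_nmin => [|r ms'] //=; first by rewrite aN.
    by exists r, ms'.
  subst ms.
  have ra : r < a.
    rewrite ltn_neqAle leqNgt a_nmin andbT; apply: contraTneq uq' => ->.
    by rewrite cat_uniq /= inE eqxx !andbF.
  case: ltnP => [aq|qa] /=.
    apply: (IHi f' a true (r :: ms') out') => //=.
    - by move: lt_f => /=; lia.
    - rewrite sorted_geq_pairwise pairwise_cat -sorted_geq_pairwise s_o /=.
      by rewrite allrel1r !andbT; apply/allP=> x /(allP out_q) /=; lia.
    - by apply/allP=> x /(allP out_q) /=; lia.
    - by move=> _; rewrite mem_cat mem_head orbT.
    - exact: ltnW.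
  have lt_q : q < N by lia.
  (* Here [q] is already output and the larger entry [a] lies above the minimum [r], so [q], [a],
     [r] is a 231. *)
  have [_ rq q_out] := qP lt_q; apply: (@stack_run_has231 _ _ _ _ _ q a r).
    rewrite (cat_subseq (s1 := [:: q]) (s2 := [:: a; r])) ?sub1seq //.
    by rewrite /= !eqxx sub0seq.
  rewrite rq ltn_neqAle qa andbT; apply: contraTneq uq' => <-.
  by rewrite cat_uniq /= q_out !andbF.
case: g => [|lt_f inpN uq s_ms s_o out_q qP _ qN]; last first.
  by apply: popped => //; rewrite ?cats0 in s_o qP *; move: lt_f; rewrite ?addn0.
move=> lt_f inpN uq s_ms s_o out_q qP /(_ isT) lt_q qN.
have [+ lt_hq _] := qP lt_q; case def_ms: ms lt_hq => [//|r ms'] /= rq _.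
(* If [a], [q], [r'] would form a forbidden pattern, then [q] is popped before [a] is read. *)
have blocked r' : r' \in ms -> (a < r' < q) || (r' < q < a) ->
    sortable_from N q true ms (a :: inp) = sortable_from N q false ms (a :: inp) ->
    let res := stack_run T132_321 f (a :: inp) (nseq true q ++ ms) out in
    if sortable_from N q true ms (a :: inp) then decr_incr res else has231 res.
  move=> r'ms arq ->; case: f lt_f => // f lt_f.
  rewrite [stack_run _ _ _ _ _]/= (push_blocked r'ms arq).
  apply: popped => //.
  - by rewrite /= in lt_f *; lia.
  - by rewrite cat_rcons.
  - by rewrite -cats1.
  - by rewrite all_rcons leqnn.
  - by move=> /qP; rewrite cats1.
rewrite -/(sortable_from N q true (r :: ms') (a :: inp)) -def_ms.
have r_ms : r \in ms by rewrite def_ms mem_head.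
case: (ltngtP a r) => [ar|ra|are].
- by apply: (blocked r) => //=; rewrite ?ar ?rq // def_ms /= ar.
- case: (ltngtP a q) => [aq|qa|aqe].
  + case has_r: (has (fun r => a < r < q) ms).
      case/hasP: (has_r) => r' r'ms arq; apply: (blocked r') => //; rewrite ?arq //=.
      by rewrite has_r.
    (* No minimum lies strictly between [a] and [q], so [a] lands on top of [q], and [a], [q], [r]
       will come out as a 231. *)
    rewrite /= has_r {1}def_ms /= (ltnNge a r) (ltnW ra) /= andbF.
    case: f lt_f {blocked} => // f lt_f; rewrite /= push_above //; last first.
      move=> x x_ms xq; rewrite leqNgt; apply: contraFN has_r => ax.
      by apply/hasP; exists x; rewrite ?ax.
    apply: (@stack_run_has231 _ _ _ _ _ a q r); rewrite ?ra //.
    rewrite -[_ :: _]cat0s cat_subseq ?sub0seq // def_ms /= !eqxx sub0seq //.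
  + apply: (blocked r) => //=; rewrite ?rq ?qa ?orbT //.
    by rewrite def_ms /= ltnNge (ltnW ra) /= ltnNge (ltnW qa).
  + have /(uniq_catF (x := q)) : uniq ((out ++ [:: q]) ++ ms ++ a :: inp) by rewrite -catA.
    by rewrite !mem_cat aqe !mem_head !orbT => /(_ isT).
- have /(uniq_catF (x := r)) : uniq ((out ++ [:: q] ++ ms) ++ a :: inp) by rewrite -!catA.
  by rewrite !mem_cat r_ms are !mem_head !orbT => /(_ isT).
Qed.

Lemma west_s_132_321_sorted n x : perm_eq x (iota 1 n) ->
  (west_s (s_132_321 x) == iota 1 n) = sortable_from n.+1 n.+1 false [::] x.
Proof.
move=> px; set y := s_132_321 x.
have py : perm_eq (west_s y) (iota 1 n).
  by do 2![apply: perm_trans (sT_perm _ _) _].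
have -> : (west_s y == iota 1 n) = sorted leq (west_s y).
  apply/eqP/idP => [->|s_y]; first by rewrite iota_sorted.
  by apply: (sorted_eq leq_trans anti_leq) => //; rewrite iota_sorted.
have ux : uniq x by rewrite (perm_uniq px) iota_uniq.
have ltx : all (fun a => a < n.+1) x.
  by rewrite (perm_all _ px); apply/allP=> a; rewrite mem_iota; lia.
have : if sortable_from n.+1 n.+1 false [::] x then decr_incr y else has231 y.
  apply: (@sortable_from_stack_run _ (2 * size x).+1 _ _ false [::] [::]) => //.
  - by rewrite addn0.
  - by rewrite ltnn.
case: ifP => _; first by move=> [o [m [-> so sm]]]; apply: west_s_decr_incr.
by move=> [b [c [m [sub_y mbc]]]]; apply: negbTE; apply: west_s_231 sub_y mbc.
Qed.

(** * Coding a permutation by its entries that are not left-to-right minima *)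

(* [None] marks a left-to-right minimum; [m] is the current minimum. *)
Fixpoint lrmin_code (m : nat) (x : seq nat) : seq (option nat) :=
  if x is a :: x' then
    if a < m then None :: lrmin_code a x' else Some a :: lrmin_code m x'
  else [::].

Fixpoint lrmins (m : nat) (x : seq nat) : seq nat :=
  if x is a :: x' then if a < m then a :: lrmins a x' else lrmins m x'
  else [::].

(* [q] is the last coded entry, and [g] tells whether it was the previous
   letter of the word. *)
Fixpoint valid_code (q : nat) (g : bool) (c : seq (option nat)) : bool :=
  match c with
  | [::] => true
  | None :: c' => valid_code q false c'
  | Some a :: c' => [&& a < q, ~~ (g && (a.+1 == q)) & valid_code a true c']
  end.

(* Positions [i] are counted from 0. *)
Fixpoint code_above (n i : nat) (c : seq (option nat)) : bool :=
  match c with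
  | [::] => true
  | None :: c' => code_above n i.+1 c'
  | Some a :: c' => (n < a + i) && code_above n i.+1 c'
  end.

Fixpoint word_of_code (c : seq (option nat)) (ms : seq nat) : seq nat :=
  match c with
  | [::] => [::]
  | None :: c' => head 0 ms :: word_of_code c' (behead ms)
  | Some a :: c' => a :: word_of_code c' ms
  end.

Definition mins_of_code n (c : seq (option nat)) :=
  [seq v <- rev (iota 1 n) | v \notin pmap id c].

Lemma valid_code_bound q g m x b :
  valid_code q g (lrmin_code m x) -> b \in x -> (b < m) || (b < q).
Proof.
elim: x q g m => //= a x IHx q g m; case: ltnP => am /=.
  by move/IHx=> H; rewrite inE => /predU1P[->|/H]; lia.
by case/and3P=> aq _ /IHx H; rewrite inE => /predU1P[->|/H]; lia.
Qed.

(** A minimum already read lies strictly between [a] and [q] exactly when [a.+1] differs from [q],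
    because every value below [q] is a minimum already read or is still to come. *)
Lemma sortable_fromE n inp q g ms :
    all (fun a => a <= n) inp -> q <= n.+1 ->
    (forall v, 0 < v <= n -> [|| v \in ms, q <= v | v \in inp]) ->
  sortable_from n.+1 q g ms inp = valid_code q g (lrmin_code (head n.+1 ms) inp).
Proof.
elim: inp q g ms => //= a inp IHi q g ms /andP[an inpn] qn cov.
case: ltnP => [am|ma] /=.
  rewrite -[X in lrmin_code X](erefl (head n.+1 (a :: ms))) -IHi // => v /cov.
  by rewrite !inE; case: (v == a); rewrite ?orbT // orFb.
case: ltnP => aq //=.
have cov' : forall v, 0 < v <= n -> [|| v \in ms, a <= v | v \in inp].
  move=> v /cov; rewrite inE; case: (v == a) / eqP => [->|_]; first by rewrite leqnn orbT.
  by case/or3P=> /= [->|qv|->]; rewrite ?orbT // (leq_trans (ltnW aq) qv) orbT.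
rewrite -IHi //; last exact: ltnW (leq_trans aq qn).
case D: (sortable_from _ _ _ _ _); rewrite ?andbF // !andbT.
case: g => //=; apply/hasP/idP => [[r _]|aq1]; first by lia.
(* The value [a.+1] cannot be still to come: by [valid_code_bound] all later entries are below the
   current minimum or below [a]. *)
exists a.+1; last by lia.
have /cov: 0 < a.+1 <= n by lia.
rewrite inE; case/or4P=> //; first by lia.
  by lia.
move: D; rewrite IHi //; last by lia.
by move=> /valid_code_bound H /H; lia.
Qed.

Lemma lrmin_codeK m x : word_of_code (lrmin_code m x) (lrmins m x) = x.
Proof. by elim: x m => //= a x IHx m; case: ifP => _ /=; rewrite IHx. Qed.

Lemma size_lrmin_code m x : size (lrmin_code m x) = size x.
Proof. by elim: x m => //= a x IHx m; case: ifP => _ /=; rewrite IHx. Qed.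

Lemma size_lrmins m x :
  size (lrmins m x) = count (fun o => ~~ isSome o) (lrmin_code m x).
Proof. by elim: x m => //= a x IHx m; case: ifP => _ /=; rewrite IHx. Qed.

Lemma path_lrmins m x : path gtn m (lrmins m x).
Proof.
elim: x m => //= a x IHx m; case: ifP => [am|_] //=; first by rewrite am IHx.
Qed.

Lemma perm_word_of_code c ms : size ms = count (fun o => ~~ isSome o) c ->
  perm_eq (word_of_code c ms) (pmap id c ++ ms).
Proof.
elim: c ms => [[] //|[a|] c IHc ms] /=; first by move=> sz; rewrite perm_cons IHc.
case: ms => // a ms [sz] /=; rewrite perm_sym -cat1s perm_catCA perm_cons perm_sym.
exact: IHc.
Qed.

Lemma mins_of_code_sorted n c : sorted gtn (mins_of_code n c).
Proof.
apply: sorted_filter; first by move=> b a d /=; lia.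
by rewrite rev_sorted iota_ltn_sorted.
Qed.

(** The minima occur in decreasing order and are the values that the code omits, so the code
    determines them, and with them the word. *)
Lemma lrminsE n x : perm_eq x (iota 1 n) ->
  lrmins n.+1 x = mins_of_code n (lrmin_code n.+1 x).
Proof.
move=> px; have /perm_word_of_code := size_lrmins n.+1 x; rewrite lrmin_codeK => px'.
have ux : uniq x by rewrite (perm_uniq px) iota_uniq.
apply: (irr_sorted_eq (leT := gtn)).
- by move=> b a d /=; lia.
- by move=> b /=; lia.
- exact: path_sorted (path_lrmins _ _).
- exact: mins_of_code_sorted.
move=> v; rewrite mem_filter mem_rev -(perm_mem px) (perm_mem px') mem_cat.
move: ux; rewrite (perm_uniq px') => ux.
case: (boolP (v \in pmap id _)) => //= v_c.
exact: uniq_catF ux v_c.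
Qed.

Lemma lrmin_code_inj n x y : perm_eq x (iota 1 n) -> perm_eq y (iota 1 n) ->
  lrmin_code n.+1 x = lrmin_code n.+1 y -> x = y.
Proof.
move=> px py eq_c; rewrite -(lrmin_codeK n.+1 x) -(lrmin_codeK n.+1 y).
by rewrite !(@lrminsE n) // eq_c.
Qed.

(** All entries after a coded entry [a] are smaller than [a]. So the values from [a] to [n], and
    also the current minimum, occur in [pre] or as [a] itself; counting them gives the bound. *)
Lemma valid_code_above n pre x q g m :
    perm_eq (pre ++ x) (iota 1 n) -> (m <= n -> m \in pre) ->
    valid_code q g (lrmin_code m x) ->
  code_above n (size pre) (lrmin_code m x).
Proof.
elim: x pre q g m => //= a x IHx pre q g m px m_pre.
have an : a <= n.
  have: a \in iota 1 n by rewrite -(perm_mem px) mem_cat mem_head orbT.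
  by rewrite mem_iota; lia.
have sz_pre : (size pre).+1 = size (rcons pre a) by rewrite size_rcons.
case: ltnP => [am|ma] /= dc; rewrite sz_pre.
  apply: IHx dc; rewrite ?cat_rcons // => _.
  by rewrite mem_rcons mem_head.
case/and3P: dc => aq _ dc; rewrite (IHx _ _ _ _ _ _ dc) ?cat_rcons ?andbT //; last first.
  by move=> mn; rewrite mem_rcons inE m_pre ?orbT.
have u_px : uniq (pre ++ a :: x) by rewrite (perm_uniq px) iota_uniq.
(* Since [m <= a <= n], the current minimum is not the initial sentinel [n.+1]. *)
have m_in : m \in pre by apply: m_pre; apply: leq_trans an.
have {ma} ma : m < a.
  rewrite ltn_neqAle ma andbT; apply: contraTneq m_in => ->.
  by apply/negP=> /(uniq_catF u_px); rewrite mem_head.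
have : size (m :: iota a (n.+1 - a)) <= size (rcons pre a).
  apply: uniq_leq_size.
    by rewrite /= iota_uniq mem_iota andbT; lia.
  move=> v; rewrite inE mem_rcons inE => /predU1P[->|]; first by rewrite m_in orbT.
  rewrite mem_iota => v_b.
  have : v \in pre ++ a :: x by rewrite (perm_mem px) mem_iota; lia.
  rewrite mem_cat inE; case/or3P=> [->|->|v_x]; rewrite ?orbT //.
  by have := valid_code_bound dc v_x; lia.
rewrite /= size_iota size_rcons; lia.
Qed.

(** The bound in [code_above] keeps a coded entry [a] from being a new minimum: otherwise [pre] and
    [a] would give [size pre + 1] distinct values between [a] and [n], contradicting
    [n < a + size pre]. *)
Lemma word_of_codeK n pre c ms m :
    uniq (pre ++ word_of_code c ms) -> all (fun v => v <= n) (pre ++ word_of_code c ms) ->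
    size ms = count (fun o => ~~ isSome o) c ->
    path gtn m ms -> all (fun v => m <= v) pre -> code_above n (size pre) c ->
  lrmin_code m (word_of_code c ms) = c.
Proof.
elim: c pre ms m => //= -[a|] c IHc pre ms m /= u_pre le_n sz_ms p_ms ge_m.
  rewrite -(size_rcons pre a) => /andP[na bc].
  case: ltnP => [am|ma].
    have /uniq_leq_size : uniq (rcons pre a).
      by move: u_pre; rewrite -cat_rcons cat_uniq => /andP[].
    have sub : {subset rcons pre a <= iota a (n.+1 - a)}.
      move=> v v_pre; rewrite mem_iota.
      have : v <= n by apply: (allP le_n); rewrite -cat_rcons mem_cat v_pre.
      move: v_pre; rewrite mem_rcons inE => /predU1P[->|/(allP ge_m)] /=; lia.
    by move/(_ _ sub); rewrite size_iota size_rcons ltn_subRL ltnS leqNgt na.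
  by rewrite (IHc (rcons pre a)) ?cat_rcons ?all_rcons ?ma.
case: ms sz_ms u_pre le_n p_ms => // v ms [sz_ms] u_pre le_n /= /andP[vm p_ms] bc.
rewrite vm (IHc (rcons pre v)) ?cat_rcons ?size_rcons ?all_rcons ?leqnn //=.
by apply/allP=> w /(allP ge_m) /=; lia.
Qed.

(** * Dyck paths *)

(** The Dyck condition from starting height [h], in a form suited to induction on the path. *)
Fixpoint walk (h : nat) (p : seq bool) : bool :=
  match p with
  | [::] => h == 0
  | true :: p' => walk h.+1 p'
  | false :: p' => (0 < h) && walk h.-1 p'
  end.

Lemma walkP h p :
  reflect (h + count id p = count negb p /\
           forall i, count negb (take i p) <= h + count id (take i p))
          (walk h p).
Proof.
elim: p h => [|[] p IHp] h /=.
- by apply: (iffP eqP) => [->|[]]; rewrite addn0.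
- apply: (iffP (IHp _)) => -[eq_c le_c]; split; try lia.
    by case=> [|i] //=; have := le_c i; lia.
  by move=> i; have := le_c i.+1; rewrite /=; lia.
- apply: (iffP andP) => [[h0 /IHp[eq_c le_c]]|[eq_c le_c]].
    by split; [lia | case=> [|i] //=; have := le_c i; lia].
  have h0 : 0 < h by have := le_c 1; rewrite /= take0 /=; lia.
  split=> //; apply/IHp; split; first by lia.
  by move=> i; have := le_c i.+1; rewrite /=; lia.
Qed.

Lemma is_dyckE p : is_dyck p = walk 0 p.
Proof.
apply/andP/walkP => [[/eqP eq_c /forallP le_c]|[eq_c le_c]]; split=> //.
- move=> i; have [le_i|/ltnW le_i] := leqP i (size p).
    exact: (le_c (Ordinal (le_i : i < (size p).+1))).
  by rewrite take_oversize // add0n eq_c.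
- by apply/eqP.
- by apply/forallP=> i; apply: le_c.
Qed.

(* The automaton of the word [dudu]: the state is the length of the longest
   suffix read so far that is a proper prefix of [dudu]. *)
Fixpoint dudu_free (s : nat) (p : seq bool) : bool :=
  match p, s with
  | [::], _ => true
  | true :: p', 1 => dudu_free 2 p'
  | true :: p', 3 => false
  | true :: p', _ => dudu_free 0 p'
  | false :: p', 2 => dudu_free 3 p'
  | false :: p', _ => dudu_free 1 p'
  end.

Lemma dudu_freeE s p : s < 4 ->
  dudu_free s p = ~~ infix dudu (take s dudu ++ p).
Proof.
by elim: p s => [|[] p IHp] [|[|[|[|//]]]] // _; rewrite [LHS]/= ?IHp //= prefix0s.
Qed.

(** * Translation between codes and lattice paths *)

Fixpoint decr_code (q : nat) (c : seq (option nat)) : bool :=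
  match c with
  | [::] => true
  | None :: c' => decr_code q c'
  | Some a :: c' => (0 < a < q) && decr_code a c'
  end.

(* [q] is the last coded entry read so far, or [n + 1]. *)
Fixpoint path_of_code (q : nat) (c : seq (option nat)) : seq bool :=
  match c with
  | [::] => nseq q.-1 false
  | None :: c' => true :: path_of_code q c'
  | Some a :: c' => nseq (q - a) false ++ true :: path_of_code a c'
  end.

(** Here [q] drops with every down step, and [q0] is its value at the last up step; thus [q < q0]
    says that the current up step ends a valley. *)
Fixpoint code_of_path (q0 q : nat) (p : seq bool) : seq (option nat) :=
  match p with
  | [::] => [::]
  | true :: p' => (if q < q0 then Some q else None) :: code_of_path q q p'
  | false :: p' => code_of_path q0 q.-1 p'
  end.

Lemma walk_nseq h k p :
  walk h (nseq k false ++ p) = (k <= h) && walk (h - k) p.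
Proof.
elim: k h => [|k IHk] h /=; first by rewrite subn0.
by rewrite IHk; case: h => //= h; rewrite subSS.
Qed.

(** After [i] up steps and [n.+1 - q] down steps the height is [q + i - n.+1]. It allows [q - a]
    further down steps exactly when [n < a + i]. *)
Lemma walk_path_of_code n i q c :
  decr_code q c -> size c + i = n -> 0 < q -> n < q + i ->
  walk (q + i - n.+1) (path_of_code q c) = code_above n i c.
Proof.
elim: c i q => [|[a|] c IHc] i q /=.
- move=> _ <- q0 _; rewrite -[nseq _ _]cats0 walk_nseq /=; lia.
- case/andP=> /andP[a0 aq] dc sz q0 lt_n; rewrite walk_nseq /=.
  have -> : (q - a <= q + i - n.+1) = (n < a + i) by lia.
  case: ltnP => //= lt_a; rewrite -(IHc _ a) //; try lia.
  by congr walk; lia.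
- move=> dc sz q0 lt_n; rewrite -(IHc _ q) //; try lia.
  by congr walk; lia.
Qed.

Lemma dudu_free_nseq k : dudu_free 1 (nseq k false).
Proof. by elim: k. Qed.

Lemma dudu_free1_nseq k p :
  dudu_free 1 (nseq k false ++ p) = dudu_free 1 p.
Proof. by elim: k. Qed.

(** State 2 means that [du] has just been read, as happens after a coded entry. The next valley then
    completes [dudu] exactly when it has a single down step, that is, [a.+1 = q]. *)
Lemma dudu_free_path_of_code q g c :
  decr_code q c -> dudu_free (if g then 2 else 0) (path_of_code q c) = valid_code q g c.
Proof.
elim: c q g => [|[a|] c IHc] q g /=.
- by case: g (q.-1) => -[|[|k]] //= _; rewrite dudu_free_nseq.
- case/andP=> /andP[_ aq] dc; rewrite aq -(IHc _ true) //=.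
  case def_k: (q - a) => [|[|k]]; first by lia.
    by have -> : (a.+1 == q) = true by [lia]; case: g.
  have -> : (a.+1 == q) = false by lia.
  by case: g; rewrite /= dudu_free1_nseq.
- by move=> dc; rewrite -(IHc _ false) //; case: g.
Qed.

Lemma size_path_of_code q c : 0 < q -> decr_code q c ->
  size (path_of_code q c) = size c + q.-1.
Proof.
elim: c q => [|[a|] c IHc] q q0 /=; first by rewrite size_nseq.
  case/andP=> /andP[a0 aq] dc; rewrite size_cat size_nseq /= IHc //; lia.
by move=> dc; rewrite IHc.
Qed.

Lemma code_of_path_nseq q0 q k p :
  code_of_path q0 q (nseq k false ++ p) = code_of_path q0 (q - k) p.
Proof.
by elim: k q => [|k IHk] q /=; rewrite ?subn0 // IHk; congr code_of_path; lia.
Qed.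

Lemma path_of_codeK q c : decr_code q c -> code_of_path q q (path_of_code q c) = c.
Proof.
elim: c q => [|[a|] c IHc] q /=.
- by rewrite -[nseq _ _]cats0 code_of_path_nseq.
- case/andP=> /andP[a0 aq] dc; rewrite code_of_path_nseq subKn; last exact: ltnW.
  by rewrite /= aq IHc.
- by move=> dc; rewrite ltnn IHc.
Qed.

(** The prefix of [q0 - q] down steps is what has been read since the last up step and not yet
    coded. *)
Lemma code_of_pathK q0 q p : 0 < q <= q0 -> count negb p = q.-1 ->
  path_of_code q0 (code_of_path q0 q p) = nseq (q0 - q) false ++ p.
Proof.
elim: p q0 q => [|[] p IHp] q0 q /= /andP[q_gt0 q_le] cnt.
- by rewrite cats0; congr nseq; lia.
- case: ltnP => [q_lt|q_ge] /=.
    by rewrite IHp ?subnn ?q_gt0 /=.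
  by have <- : q = q0 by [lia]; rewrite IHp ?subnn ?q_gt0 /=.
- rewrite IHp; try lia.
  have -> : q0 - q.-1 = q0 - q + 1 by lia.
  by rewrite nseqD -catA.
Qed.

Lemma decr_code_of_path q0 q p : 0 < q <= q0 -> count negb p = q.-1 ->
  decr_code q0 (code_of_path q0 q p).
Proof.
elim: p q0 q => [|[] p IHp] q0 q //= /andP[q_gt0 q_le] cnt; last first.
  by apply: IHp; lia.
case: ltnP => [q_lt|q_ge] /=; first by rewrite q_gt0 q_lt IHp ?q_gt0 /=.
by have -> : q0 = q by [lia]; apply: IHp; rewrite ?q_gt0 /=.
Qed.

Lemma size_code_of_path q0 q p : size (code_of_path q0 q p) = count id p.
Proof. by elim: p q0 q => [|[] p IHp] q0 q //=; rewrite IHp. Qed.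

(** Positivity of a coded entry [a] comes from [n < a + i], as its position satisfies [i < n]. *)
Lemma valid_code_decr n q g i c : size c + i = n ->
  valid_code q g c -> code_above n i c -> decr_code q c.
Proof.
elim: c q g i => [|[a|] c IHc] q g i //= sz.
  case/and3P=> -> _ dc /andP[lt_n bc].
  by rewrite (IHc _ _ _ _ dc bc) ?andbT /=; lia.
by move=> dc bc; apply: IHc dc bc; lia.
Qed.

(** * The bijection *)

Lemma perm_word_perm n (s : 'S_n) : perm_eq (perm_word s) (iota 1 n).
Proof.
apply: uniq_perm; rewrite ?iota_uniq //.
  by rewrite map_inj_uniq ?enum_uniq // => i j [] /val_inj /perm_inj.
move=> v; rewrite mem_iota; apply/mapP/idP => [[i _ ->]|].
  by have := ltn_ord (s i); rewrite /=; lia.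
case: v => // v lt_v; have lt_vn : v < n by lia.
exists (s^-1 (Ordinal lt_vn))%g; rewrite ?mem_enum //.
by rewrite permKV.
Qed.

Lemma perm_word_inj n : injective (@perm_word n).
Proof.
move=> s t /eq_in_map eq_st; apply/permP=> i; apply: val_inj.
by have [] := eq_st i (mem_enum _ _).
Qed.

Lemma perm_word_onto n x : perm_eq x (iota 1 n) ->
  exists s : 'S_n, perm_word s = x.
Proof.
move=> px; have sz_x : size x = n by rewrite (perm_size px) size_iota.
have ux : uniq x by rewrite (perm_uniq px) iota_uniq.
have x_bd (i : 'I_n) : 0 < nth 0 x i <= n.
  have : nth 0 x i \in iota 1 n by rewrite -(perm_mem px) mem_nth ?sz_x.
  by rewrite mem_iota; lia.
have lt_x (i : 'I_n) : (nth 0 x i).-1 < n by have := x_bd i; lia.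
have inj_f : injective (fun i => Ordinal (lt_x i)).
  move=> i j [] eq_x; have := x_bd i; have := x_bd j => ? ?.
  have /eqP : nth 0 x i = nth 0 x j by lia.
  by rewrite nth_uniq ?sz_x // => /eqP/val_inj.
exists (perm inj_f); apply: (@eq_from_nth _ 0) => [|i].
  by rewrite size_map size_enum_ord sz_x.
rewrite size_map size_enum_ord => lt_i.
rewrite (nth_map (Ordinal lt_i)) ?size_enum_ord // permE /=.
rewrite nth_enum_ord //.
by have /andP[/prednK] := x_bd (Ordinal lt_i).
Qed.

Lemma mem_Sort n (s : 'S_n) :
  (s \in Sort_132_321 n) = valid_code n.+1 false (lrmin_code n.+1 (perm_word s)).
Proof.
rewrite inE west_s_132_321_sorted ?perm_word_perm // sortable_fromE //.
  by rewrite (perm_all _ (perm_word_perm s)); apply/allP=> a; rewrite mem_iota; lia.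
by move=> v v_n; rewrite (perm_mem (perm_word_perm s)) mem_iota; lia.
Qed.

Definition path_of_word n x := path_of_code n.+1 (lrmin_code n.+1 x).

Lemma lrmin_code_decr n x : perm_eq x (iota 1 n) ->
  valid_code n.+1 false (lrmin_code n.+1 x) ->
  decr_code n.+1 (lrmin_code n.+1 x) /\ code_above n 0 (lrmin_code n.+1 x).
Proof.
move=> px dc; have bc : code_above n 0 (lrmin_code n.+1 x).
  by apply: (@valid_code_above n [::]) dc => //; rewrite ltnn.
split=> //; apply: valid_code_decr dc bc.
by rewrite size_lrmin_code (perm_size px) size_iota addn0.
Qed.

Lemma path_of_word_dyck n x : perm_eq x (iota 1 n) ->
  valid_code n.+1 false (lrmin_code n.+1 x) ->
  [/\ size (path_of_word n x) = 2 * n, is_dyck (path_of_word n x)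
    & ~~ infix dudu (path_of_word n x)].
Proof.
move=> px dc; have [ds bc] := lrmin_code_decr px dc.
have sz : size (lrmin_code n.+1 x) = n by rewrite size_lrmin_code (perm_size px) size_iota.
split; first by rewrite size_path_of_code // sz; lia.
- by rewrite is_dyckE -(subnn n.+1) -{1}(addn0 n.+1) walk_path_of_code // ?addn0.
- by rewrite -(@dudu_freeE 0) // (dudu_free_path_of_code false).
Qed.

(** The code [c] is read off the path, and its marks [None] are filled with the omitted values in
    decreasing order. Staying above the axis makes these exactly the minima of the resulting
    word. *)
Lemma path_of_word_onto n (p : seq bool) :
    size p = 2 * n -> is_dyck p -> ~~ infix dudu p ->
  exists x, [/\ perm_eq x (iota 1 n), valid_code n.+1 false (lrmin_code n.+1 x)
              & path_of_word n x = p].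
Proof.
move=> sz_p dyck_p dudu_p.
have /andP[/eqP eq_c _] := dyck_p.
have cnt_p : count id p + count negb p = 2 * n by rewrite -sz_p count_predC.
have cntN : count negb p = n.+1.-1 by lia.
have q_bd : 0 < n.+1 <= n.+1 by rewrite leqnn.
pose c := code_of_path n.+1 n.+1 p.
have sz_c : size c = n by rewrite size_code_of_path; lia.
have ds : decr_code n.+1 c by apply: decr_code_of_path.
have enc_c : path_of_code n.+1 c = p by rewrite code_of_pathK // subnn.
have dc : valid_code n.+1 false c.
  by rewrite -(dudu_free_path_of_code false ds) enc_c dudu_freeE.
have bc : code_above n 0 c.
  by rewrite -(walk_path_of_code ds) ?sz_c ?addn0 // enc_c subnn -is_dyckE.
pose ms := mins_of_code n c; pose x := word_of_code c ms.
have decr_mem q c' v : decr_code q c' -> v \in pmap id c' -> 0 < v < q.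
  elim: c' q => [|[a|] c' IHc] q //=; last exact: IHc.
  case/andP=> aq /IHc H; rewrite inE => /predU1P[->|/H] //; lia.
have decr_uniq q c' : decr_code q c' -> uniq (pmap id c').
  elim: c' q => [|[a|] c' IHc] q //=; last exact: IHc.
  case/andP=> aq dc'; rewrite (IHc a) // andbT; apply/negP=> /(decr_mem _ _ _ dc'); lia.
have perm_c : perm_eq (pmap id c ++ ms) (iota 1 n).
  apply: uniq_perm; rewrite ?iota_uniq //.
    rewrite cat_uniq (decr_uniq _ _ ds) filter_uniq ?rev_uniq ?iota_uniq // andbT.
    by apply/hasPn=> v; rewrite mem_filter => /andP[].
  move=> v; rewrite mem_cat mem_filter mem_rev.
  case: (boolP (v \in pmap id c)) => //= /(decr_mem _ _ _ ds).
  by rewrite mem_iota; lia.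
have sz_ms : size ms = count (fun o => ~~ isSome o) c.
  have := perm_size perm_c; rewrite size_cat size_iota size_pmap.
  have := count_predC isSome c; rewrite sz_c => <- /eqP.
  by rewrite eqn_add2l => /eqP.
have px : perm_eq x (iota 1 n) := perm_trans (perm_word_of_code sz_ms) perm_c.
have ms_p : path gtn n.+1 ms.
  have := mins_of_code_sorted n c; rewrite -/ms.
  case def_ms: ms => [//|v ms'] /= ->; rewrite andbT.
  have : v \in ms by rewrite def_ms mem_head.
  by rewrite mem_filter mem_rev mem_iota => /andP[_]; lia.
have lc : lrmin_code n.+1 x = c.
  apply: (@word_of_codeK n [::]) => //; first by rewrite (perm_uniq px) iota_uniq.
  by rewrite (perm_all _ px); apply/allP=> v; rewrite mem_iota; lia.
by exists x; rewrite /path_of_word lc.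
Qed.

Theorem theorem1p1 (n : nat) : 1 <= n ->
  #|Sort_132_321 n| = #|dyck_no_dudu n|.
Proof.
move=> _; rewrite !cardE.
(* Both cardinals become lengths of duplicate-free lists of step words, so comparing their members
   suffices. *)
rewrite -(size_map (fun s => path_of_word n (perm_word s))).
rewrite -(size_map val (enum (dyck_no_dudu n))).
apply: perm_size; apply: uniq_perm.
- rewrite map_inj_in_uniq ?enum_uniq // => s t.
  rewrite !mem_enum !mem_Sort => ds dt eq_p; apply: perm_word_inj.
  have [Ds _] := lrmin_code_decr (perm_word_perm s) ds.
  have [Dt _] := lrmin_code_decr (perm_word_perm t) dt.
  apply: (lrmin_code_inj (perm_word_perm s) (perm_word_perm t)).
  by rewrite -(path_of_codeK Ds) -(path_of_codeK Dt); congr code_of_path.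
- by rewrite map_inj_uniq ?enum_uniq //; apply: val_inj.
move=> p; apply/mapP/mapP => [[s]|[t]].
  rewrite mem_enum mem_Sort => ds ->.
  have [sz dy du] := path_of_word_dyck (perm_word_perm s) ds.
  by exists (Tuple (introT eqP sz)); rewrite // mem_enum inE dy du.
rewrite mem_enum inE => /andP[dy du] ->.
have [x [px dx def_t]] := path_of_word_onto (size_tuple t) dy du.
have [s def_x] := perm_word_onto px.
by exists s; rewrite ?def_x ?def_t // mem_enum mem_Sort def_x.
Qed.
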